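(* Let $r\ge 1$, let $\boldsymbol{\mu}=(\mu_1,\dots,\mu_r)$ be a system of (possibly complex) measures on $\mathbb{R}$ with all moments finite, and let $\boldsymbol{n}\in\mathbb{N}^r$ be a multi-index that is normal with respect to $\boldsymbol{\mu}$. Let $P_{\boldsymbol{n}}$ be the type II multiple orthogonal polynomial of $\boldsymbol{\mu}$ at $\boldsymbol{n}$. Then $$\{z_0\in\mathbb{C}: P_{\boldsymbol{n}}(z_0)=0\}=\{z_0\in\mathbb{C}: \boldsymbol{n}\text{ is not normal for the system }((x-z_0)\mu_1,\dots,(x-z_0)\mu_r)\}.$$
   Context: $\mathbb{N}=\{0,1,2,\dots\}$; for $\boldsymbol{n}=(n_1,\dots,n_r)\in\mathbb{N}^r$, $|\boldsymbol{n}|=n_1+\dots+n_r$. A type II multiple orthogonal polynomial for a system $\boldsymbol{\mu}=(\mu_1,\dots,\mu_r)$ of (possibly complex) measures on $\mathbb{R}$ with finite moments, at $\boldsymbol{n}$, is a monic polynomial $P_{\boldsymbol{n}}$ of exact degree $|\boldsymbol{n}|$ with $\int P_{\boldsymbol{n}}(x)x^k\,d\mu_j(x)=0$ for $k=0,\dots,n_j-1$ and $j=1,\dots,r$. The index $\boldsymbol{n}$ is called normal with respect to $\boldsymbol{\mu}$ if such a $P_{\boldsymbol{n}}$ exists and is unique. Equivalently, the $|\boldsymbol{n}|\times|\boldsymbol{n}|$ matrix obtained by stacking, for $j=1,\dots,r$, the $n_j\times|\boldsymbol{n}|$ blocks $\big(\int x^{p+q}d\mu_j(x)\big)_{0\le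 p\le n_j-1,\,0\le q\le|\boldsymbol{n}|-1}$ has non-zero determinant (the empty determinant being $1$). For a measure $\mu$ and $z_0\in\mathbb{C}$, $(x-z_0)\mu$ denotes the measure $\widehat\mu$ with $\int f\,d\widehat\mu=\int f(x)(x-z_0)\,d\mu(x)$. *)

(* Defs.v *)
From HB Require Import structures.
From mathcomp Require Import all_boot all_order all_algebra.
From mathcomp Require Import complex.
From mathcomp Require Import all_classical all_reals all_analysis.

Set Implicit Arguments.
Unset Strict Implicit.
Unset Printing Implicit Defensive.

Import Order.TTheory GRing.Theory Num.Theory.
Import numFieldNormedType.Exports.

Local Open Scope classical_set_scope.
Local Open Scope ring_scope.
Local Open Scope complex_scope.

(* Integration against a finite signed measure. A Hahn decomposition is chosen;
   the resulting Jordan parts do not depend on that choice. *)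
Section signed_integral.
Context d (T : measurableType d) (R : realType).
Implicit Types (nu : {charge set T -> \bar R}) (f : T -> R).

Lemma hahn_exists nu :
  exists PN : set T * set T, hahn_decomposition nu PN.1 PN.2.
Proof. by have [P [N h]] := Hahn_decomposition nu; exists (P, N). Qed.

Definition pos_part nu : {finite_measure set T -> \bar R} :=
  jordan_pos (projT2 (cid (hahn_exists nu))).

Definition neg_part nu : {finite_measure set T -> \bar R} :=
  jordan_neg (projT2 (cid (hahn_exists nu))).

Definition signed_integrable nu f : Prop :=
  (pos_part nu).-integrable setT (EFin \o f) /\
  (neg_part nu).-integrable setT (EFin \o f).

Definition signed_integral nu (A : set T) f : R :=
  Rintegral (pos_part nu) A f - Rintegral (neg_part nu) A f.

(* f nu : A |-> \int_A f d(nu^+) - \int_A f d(nu^-) *)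
Definition signed_density nu f (h : signed_integrable nu f) :
    {charge set T -> \bar R} :=
  cadd (induced_charge h.1) (copp (induced_charge h.2)).

End signed_integral.

(* A complex measure is mu = re_part mu + i im_part mu with finite signed real
   and imaginary parts. *)
Record complex_measure d (T : measurableType d) (R : realType) :=
  ComplexMeasure {
    re_part : {charge set T -> \bar R} ;
    im_part : {charge set T -> \bar R} }.

Section complex_integral.
Context d (T : measurableType d) (R : realType).
Implicit Types (mu : complex_measure T R) (g : T -> R[i]).

Definition cmeasure mu (A : set T) : R[i] :=
  fine (re_part mu A) +i* fine (im_part mu A).

Definition complex_integrable mu g : Prop :=
  [/\ signed_integrable (re_part mu) (fun x => complex.Re (g x)),
      signed_integrable (re_part mu) (fun x => complex.Im (g x)),
      signed_integrable (im_part mu) (fun x => complex.Re (g x)) &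
      signed_integrable (im_part mu) (fun x => complex.Im (g x))].

Definition complex_integral mu (A : set T) g : R[i] :=
  (signed_integral (re_part mu) A (fun x => complex.Re (g x)) -
   signed_integral (im_part mu) A (fun x => complex.Im (g x))) +i*
  (signed_integral (im_part mu) A (fun x => complex.Re (g x)) +
   signed_integral (re_part mu) A (fun x => complex.Im (g x))).

(* The complex measure g mu, i.e. A |-> \int_A g dmu
   (see complex_densityE below). *)
Definition complex_density mu g (h : complex_integrable mu g) :
    complex_measure T R :=
  let: And4 hrr hri hir hii := h in
  ComplexMeasure
    (cadd (signed_density hrr) (copp (signed_density hii)))
    (cadd (signed_density hir) (signed_density hri)).

Lemma signed_densityE (nu : {charge set T -> \bar R}) (f : T -> R)
    (h : signed_integrable nu f) (A : set T) : measurable A ->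
  signed_density h A = (signed_integral nu A f)%:E.
Proof.
move=> mA; case: h => hp hn.
rewrite /signed_density /= /cadd /copp /= /signed_integral EFinB /induced_charge.
rewrite /Rintegral !fineK //; apply: integrable_fin_num => //.
  by apply: (integrableS _ _ _ hn).
by apply: (integrableS _ _ _ hp).
Qed.

Lemma complex_densityE mu g (h : complex_integrable mu g) (A : set T) :
  measurable A -> cmeasure (complex_density h) A = complex_integral mu A g.
Proof.
move=> mA; case: h => hrr hri hir hii.
rewrite /cmeasure /complex_density /complex_integral /= /cadd /copp /=.
by rewrite -[copp _ A]/(- signed_density hii A)%E !signed_densityE.
Qed.

End complex_integral.

Section real_line.
Context (R : realType).
Implicit Types (mu : complex_measure (measurableTypeR R) R) (z : R[i]).

Definition finite_moments mu : Prop :=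
  forall k : nat, complex_integrable mu (fun x : R => x%:C ^+ k).

Lemma signed_integrable_lin (nu : {charge set (measurableTypeR R) -> \bar R})
    (a b : R) :
  signed_integrable nu (fun x : R => x) ->
  signed_integrable nu (fun x : R => a * x + b).
Proof.
have H (m : {finite_measure set (measurableTypeR R) -> \bar R}) :
    m.-integrable setT (EFin \o (fun x : R => x)) ->
    m.-integrable setT (EFin \o (fun x : R => a * x + b)).
  move=> h.
  rewrite (_ : EFin \o _ =
    ((fun x : R => a%:E * (EFin \o (fun x : R => x)) x) \+ cst b%:E)%E) //.
  apply: integrableD => //; first exact: integrableZl.
  exact: finite_measure_integrable_cst.
by case=> hp hn; split; exact: H.
Qed.

Lemma integrable_subC mu z :
  finite_moments mu -> complex_integrable mu (fun x : R => x%:C - z).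
Proof.
case: z => a b /(_ 1%N) [hr _ hi _].
have eRe : (fun x : R => complex.Re (x%:C - (a +i* b))) =
  (fun x => 1 * x + - a) by apply/funext => x /=; rewrite mul1r.
have eIm : (fun x : R => complex.Im (x%:C - (a +i* b))) =
  (fun x => 0 * x + - b) by apply/funext => x /=; rewrite mul0r.
by split; rewrite ?eRe ?eIm; apply: signed_integrable_lin.
Qed.

(* (x - z) mu *)
Definition shifted_measure mu (h : finite_moments mu) z :
    complex_measure (measurableTypeR R) R :=
  complex_density (integrable_subC z h).

Definition typeII_MOP (r : nat)
    (mu : 'I_r -> complex_measure (measurableTypeR R) R) (n : 'I_r -> nat)
    (P : {poly R[i]}) : Prop :=
  [/\ P \is monic, size P = (\sum_(j < r) n j).+1 &
      forall (j : 'I_r) (k : nat), (k < n j)%N ->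
        complex_integral (mu j) setT (fun x : R => P.[x%:C] * x%:C ^+ k) = 0].

Definition normal_index (r : nat)
    (mu : 'I_r -> complex_measure (measurableTypeR R) R) (n : 'I_r -> nat) :
    Prop :=
  exists! P : {poly R[i]}, typeII_MOP mu n P.

End real_line.

(* Main.v *)
(** The orthogonality conditions are |n| linear functionals l_i on polynomials,
    and, by counting dimensions, n is normal iff no nonzero Q with deg Q < |n|
    is annihilated by all of them. Passing to (x - z) mu replaces l_i by
    Q |-> l_i ((X - z) Q). If P(z) = 0, then P / (X - z) is annihilated by the
    new functionals. Conversely, if a nonzero Q of degree less than |n| is
    annihilated by them, then (X - z) Q has degree exactly |n| because n is
    normal for mu, so it is proportional to P, and P(z) = 0. *)
Require Import Defs.
From HB Require Import structures.
From mathcomp Require Import all_boot all_order all_algebra.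
From mathcomp Require Import complex.
From mathcomp Require Import all_classical all_reals all_analysis.
From mathcomp Require Import measurable_realfun.
From mathcomp Require Import ring.
Set Implicit Arguments.
Unset Strict Implicit.
Unset Printing Implicit Defensive.
Import Order.TTheory GRing.Theory Num.Theory.

Local Open Scope classical_set_scope.
Local Open Scope ring_scope.
Local Open Scope complex_scope.

(** * Linear algebra of monic polynomials annihilated by finitely many functionals *)

Section monic_annihilated.
Variables (F : fieldType) (I : finType).
Implicit Types (l : I -> {poly F} -> F) (P Q : {poly F}) (z : F).

(** Abstract form of [typeII_MOP]: [I] indexes the orthogonality conditions, so their number is also
    the degree. *)
Definition monic_annihilated l P :=
  [/\ P \is monic, size P = #|I|.+1 & forall i, l i P = 0].

(** For linear [l], this is the non-vanishing of the moment determinant, stated without a matrix. *)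
Definition trivial_annihilator l :=
  forall Q, (size Q <= #|I|)%N -> (forall i, l i Q = 0) -> Q = 0.

Lemma scalar_sum (f : {poly F} -> F) (hf : scalar f) (J : finType)
    (a : J -> F) (p : J -> {poly F}) :
  f (\sum_j a j *: p j) = \sum_j a j * f (p j).
Proof.
have f0 : f 0 = 0.
  by have := hf (-1) 0 0; rewrite scaleN1r addr0 oppr0 mulN1r addNr.
by elim/big_rec2: _ => // j x y _ <-; rewrite hf.
Qed.

(** As many functionals as coefficients give a square system; being injective it is invertible, so
    the values on ['X^N] are matched by some [R] of lower degree, and ['X^N - R] is annihilated. *)
Lemma trivial_annihilator_unique_monic l (hl : forall i, scalar (l i)) :
  trivial_annihilator l -> exists! P, monic_annihilated l P.
Proof.
move=> triv; set N := #|I|.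
(* Rows are indexed by monomials and columns by functionals, so [v *m A] lists the values of the
   functionals at the polynomial with coefficient row [v]. *)
pose A : 'M[F]_N := \matrix_(k, i) l (enum_val i) 'X^k.
have lE (v : 'rV_N) i : l i (rVpoly v) = (v *m A) 0 (enum_rank i).
  rewrite /rVpoly poly_def scalar_sum// mxE; apply: eq_bigr => k _.
  by rewrite mxE enum_rankK insubT//= => klt; congr (v _ _ * _); apply: val_inj.
have Afree : A \in unitmx.
  rewrite -row_free_unit -kermx_eq0; apply/rowV0P => v /sub_kermxP vA0.
  suff : rVpoly v = 0 by move/(congr1 (poly_rV (d := N))); rewrite rVpolyK linear0.
  by apply: triv => [|i]; [exact: size_poly|rewrite lE vA0 mxE].
pose w : 'rV[F]_N := \row_i l (enum_val i) 'X^N.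
pose R := rVpoly (w *m invmx A).
have lR i : l i R = l i 'X^N by rewrite lE mulmxKV// mxE enum_rankK.
have sR : (size R <= N)%N by exact: size_poly.
have lB i P Q : l i (P - Q) = l i P - l i Q.
  by rewrite -scaleN1r addrC hl mulN1r addrC.
exists ('X^N - R); split.
  split=> [| |i]; last by rewrite lB lR subrr.
    by rewrite monicE lead_coefDl ?lead_coefXn// size_polyN size_polyXn ltnS.
  by rewrite size_polyDl size_polyXn// size_polyN ltnS.
move=> P [mP sP lP]; apply/eqP; rewrite -subr_eq0; apply/eqP.
apply: triv => [|i]; last by rewrite !lB lR lP subrr subr0.
(* Only the coefficient at [k = N] needs care: there the two leading coefficients, both 1,
   cancel. *)
apply/leq_sizeP => k Nk; rewrite !coefB coefXn (leq_sizeP _ _ sR)// subr0.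
move: Nk; rewrite leq_eqVlt => /orP[/eqP <-|Nk]; last first.
  by rewrite gtn_eqF// [P`_k]nth_default ?sP// subrr.
by move: mP; rewrite eqxx monicE /lead_coef sP => /eqP ->; rewrite subrr.
Qed.

(** Adding an annihilated [Q] of lower degree to [P] yields another monic solution, so uniqueness
    forces [Q = 0]. *)
Lemma unique_monic_trivial_annihilator l (hl : forall i, scalar (l i)) :
  (exists! P, monic_annihilated l P) -> trivial_annihilator l.
Proof.
move=> [P [[mP sP lP] uP]] Q sQ lQ.
have lD i : l i (P + Q) = 0.
  by rewrite addrC -[Q]scale1r hl lQ lP mulr0 addr0.
suff : P = P + Q by move/(congr1 (+%R (- P))); rewrite addKr addNr.
apply: uP; split=> //; last by rewrite size_polyDl sP.
by rewrite monicE lead_coefDl ?sP//; rewrite -monicE.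
Qed.

Lemma root_monic_annihilated l (hl : forall i, scalar (l i)) P z :
  (exists! P, monic_annihilated l P) -> monic_annihilated l P ->
  root P z <->
  ~ exists! Q, monic_annihilated (fun i Q => l i (('X - z%:P) * Q)) Q.
Proof.
move=> exP [mP sP lP]; set l' := fun i Q => _.
have hl' i : scalar (l' i).
  by move=> a p q; rewrite /l' mulrDr -scalerAr hl.
have Xz0 : 'X - z%:P != 0 :> {poly F} by rewrite polyXsubC_eq0.
have triv := unique_monic_trivial_annihilator hl exP.
split.
  case/factor_theorem => Q PE /(unique_monic_trivial_annihilator hl').
  have Q0 : Q != 0.
    by apply: contraTneq mP => Q0; rewrite PE Q0 mul0r monicE lead_coef0 eq_sym oner_eq0.
  move=> /(_ Q); rewrite /l' mulrC -PE => /(_ _ lP) QE.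
  case/eqP: (Q0); apply: QE.
  by move: sP; rewrite PE size_Mmonic ?monicXsubC// size_XsubC addn2 => -[->].
move=> nexQ; apply/negPn/negP => Pz; apply: nexQ.
apply: trivial_annihilator_unique_monic => // Q sQ lQ.
apply/eqP/negPn/negP => Q0; case/negP: Pz.
set S := ('X - z%:P) * Q.
have S0 : S != 0 by rewrite mulf_neq0.
have sS : size S = (size Q).+1 by rewrite /S mulrC size_mul// size_XsubC addn2.
(* If [size Q < #|I|], then [S] still has degree below [#|I|] and is annihilated by [l], hence zero,
   a contradiction. So [S] has degree exactly [#|I|], and its monic multiple must be [P]. *)
move: sQ; rewrite leq_eqVlt => /orP[/eqP sQ|sQ]; last first.
  by case/eqP: S0; apply: triv; rewrite ?sS.
have [P0 [_ uP]] := exP.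
suff PE : P = (lead_coef S)^-1 *: S.
  by rewrite PE rootZ ?invr_eq0 ?lead_coef_eq0// rootM root_XsubC eqxx.
rewrite -(uP P)//; apply: uP; split.
- by rewrite monicE lead_coefZ mulVf// lead_coef_eq0.
- by rewrite size_scale ?invr_eq0 ?lead_coef_eq0// sS sQ.
(* Homogeneity is read off the combined form [a *: u + v] of linearity, with [u = v = S] and [a] one
   less than the wanted factor. *)
move=> i; have := hl i ((lead_coef S)^-1 - 1) S S.
rewrite -[l i S]/(l' i Q) lQ mulr0 addr0 => <-.
by rewrite scalerBl scale1r subrK.
Qed.

End monic_annihilated.

(** * Measures with a nonnegative integrable density *)

Section density_measure.
Context d (T : measurableType d) (R : realType).
Variables (m : {measure set T -> \bar R}) (h : T -> R).
Hypotheses (h0 : forall x, 0 <= h x) (ih : m.-integrable setT (EFin \o h)).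

Let induced_ge0 A : (0 <= induced_charge ih A)%E.
Proof. by apply: integral_ge0 => x _; rewrite lee_fin. Qed.

(** The charge is promoted to a measure, and by the instances below to a finite one, so that one can
    integrate against it and apply Radon-Nikodym. *)
Definition density_measure := measure_of_charge (induced_charge ih) induced_ge0.

HB.instance Definition _ := Measure.on density_measure.

Let density_measure_fin : fin_num_fun density_measure.
Proof. by move=> A mA; exact: (@fin_num_measure _ _ _ (induced_charge ih)). Qed.

HB.instance Definition _ := @Measure_isFinite.Build _ _ _
  density_measure density_measure_fin.

End density_measure.

Section density_measure_integral.
Context d (T : measurableType d) (R : realType).
Variables (m : {finite_measure set T -> \bar R}) (h : T -> R).
Hypotheses (h0 : forall x, 0 <= h x) (ih : m.-integrable setT (EFin \o h)).
Let mh := density_measure h0 ih.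

(** The Radon-Nikodym derivative of [mh] with respect to [m] is almost everywhere [h], which reduces
    the claim to the change of variables formula for that derivative. *)
Lemma ge0_integral_density_measure (f : T -> \bar R) :
  (forall x, 0 <= f x)%E -> measurable_fun setT f ->
  (\int[mh]_x f x = \int[m]_x (f x * (h x)%:E))%E.
Proof.
move=> f0 mf.
have mh_m : mh `<< m.
  apply/null_content_dominatesP => A mA mA0.
  apply: null_set_integral => //.
  exact: measurable_funTS (measurable_int _ ih).
rewrite -(Radon_Nikodym_SigmaFinite.change_of_variables mh_m f0)//.
have irn := Radon_Nikodym_SigmaFinite.f_integrable mh_m.
apply: ae_eq_integral => //.
- by apply: emeasurable_funM => //; exact: (measurable_int _ irn).
- by apply: emeasurable_funM => //; exact: (measurable_int _ ih).
(* The derivative and [h] have the same integral, [mh E], over every measurable [E], hence agree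
   almost everywhere. *)
apply: ae_eqe_mul2l; apply: integral_ae_eq => //.
  exact: (measurable_int _ ih).
by move=> E _ mE; rewrite -Radon_Nikodym_SigmaFinite.f_integral.
Qed.

Lemma integrable_density_measure (f : T -> R) : measurable_fun setT f ->
  m.-integrable setT (EFin \o (fun x => f x * h x)) ->
  mh.-integrable setT (EFin \o f).
Proof.
move=> mf /integrableP[_ fhoo]; apply/integrableP; split.
  exact/measurable_EFinP.
rewrite ge0_integral_density_measure//; last first.
  by apply: measurableT_comp => //; exact/measurable_EFinP.
apply: le_lt_trans fhoo; rewrite le_eqVlt; apply/orP; left; apply/eqP.
by apply: eq_integral => x _ /=; rewrite -EFinM normrM (ger0_norm (h0 x)).
Qed.

Lemma integral_density_measure (f : T -> R) : measurable_fun setT f ->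
  (\int[mh]_x (f x)%:E = \int[m]_x (f x * h x)%:E)%E.
Proof.
move=> mf; rewrite [LHS]integralE [RHS]integralE.
have mf' : measurable_fun setT (EFin \o f) by exact/measurable_EFinP.
congr (_ - _)%E.
  rewrite ge0_integral_density_measure//; last exact: measurable_funepos.
  apply: eq_integral => x _.
  by rewrite !funeposE -!EFin_max -EFinM maxr_pMl// mul0r.
rewrite ge0_integral_density_measure//; last exact: measurable_funeneg.
apply: eq_integral => x _.
by rewrite !funenegE -!EFinN -!EFin_max -EFinM maxr_pMl// mul0r mulNr.
Qed.

End density_measure_integral.

(** * Integrals against charges split as differences of measures *)

Section has_integral.
Context d (T : measurableType d) (R : realType).
Implicit Types (nu : {charge set T -> \bar R}) (f : T -> R) (v : R).

(* An arbitrary, possibly non-minimal, splitting of nu into a difference of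
   measures is allowed; unlike the Jordan decomposition, such splittings are
   stable under sums, opposites and densities. *)
Definition has_integral nu f v := exists m1 m2 : {measure set T -> \bar R},
  [/\ forall A, measurable A -> (nu A + m2 A = m1 A)%E,
      m1.-integrable setT (EFin \o f),
      m2.-integrable setT (EFin \o f) &
      v = Rintegral m1 setT f - Rintegral m2 setT f].

Lemma integrable_measure_add (m1 m2 : {measure set T -> \bar R}) f :
  m1.-integrable setT (EFin \o f) -> m2.-integrable setT (EFin \o f) ->
  (measure_add m1 m2).-integrable setT (EFin \o f).
Proof.
move=> /integrableP[mf i1] /integrableP[_ i2]; apply/integrableP; split => //.
rewrite ge0_integral_measure_add//; first exact: lte_add_pinfty.
exact: measurableT_comp.
Qed.

Lemma Rintegral_measure_add (m1 m2 : {measure set T -> \bar R}) f :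
  m1.-integrable setT (EFin \o f) -> m2.-integrable setT (EFin \o f) ->
  Rintegral (measure_add m1 m2) setT f = Rintegral m1 setT f + Rintegral m2 setT f.
Proof.
move=> i1 i2; rewrite /Rintegral integral_measure_add//.
by rewrite fineD//; exact: integrable_fin_num.
Qed.

Lemma le_measure_integrable (m1 m2 : {measure set T -> \bar R}) f :
  (forall A, measurable A -> m1 A <= m2 A)%E ->
  m2.-integrable setT (EFin \o f) -> m1.-integrable setT (EFin \o f).
Proof.
move=> m12 /integrableP[mf i2]; apply/integrableP; split => //.
apply: le_lt_trans i2; apply: ge0_le_measure_integral => //.
exact: measurableT_comp.
Qed.

(** On subsets of the positive Hahn set [nu] is at most [m1], and on subsets of the negative one
    [- nu] is at most [m2], so the Jordan parts inherit integrability. This allows sums and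
    densities to be integrated without computing their Hahn decompositions. *)
Lemma has_integral_signed nu f v : has_integral nu f v ->
  signed_integrable nu f /\ signed_integral nu setT f = v.
Proof.
move=> [m1 [m2 [num i1 i2 ->]]].
rewrite /signed_integrable /signed_integral /pos_part /neg_part.
case: (cid (hahn_exists nu)) => -[P N] /= PN.
have [[mP _] [mN _] _ _] := PN.
have mpos A : measurable A -> (jordan_pos PN A <= m1 A)%E.
  move=> mA; rewrite jordan_posE cjordan_posE /crestr0 mem_set// /crestr.
  apply: (@le_trans _ _ (m1 (A `&` P))).
    by rewrite -num ?leeDl//; exact: measurableI.
  by apply: le_measure; rewrite ?inE//; exact: measurableI.
have mneg A : measurable A -> (jordan_neg PN A <= m2 A)%E.
  move=> mA; rewrite jordan_negE cjordan_negE /crestr0 mem_set// /crestr.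
  have mAN : measurable (A `&` N) by exact: measurableI.
  apply: (@le_trans _ _ (m2 (A `&` N))).
    by rewrite -[leLHS]add0e leeBlDr ?fin_num_measure// addeC num.
  by apply: le_measure; rewrite ?inE.
have ip := le_measure_integrable mpos i1.
have iN := le_measure_integrable mneg i2.
split=> //.
(* The Jordan parts lie below m1 and m2, and the two splittings of nu agree
   after moving the subtracted measures to the other side. *)
suff : Rintegral (jordan_pos PN) setT f + Rintegral m2 setT f =
       Rintegral m1 setT f + Rintegral (jordan_neg PN) setT f.
  by move/eqP; rewrite -subr_eq addrAC => /eqP <-; rewrite addrK.
rewrite -!Rintegral_measure_add//; congr fine.
apply: eq_measure_integral => A mA _.
rewrite [LHS]measure_addE [RHS]measure_addE -num// (jordan_decomp PN mA).
rewrite /cadd [RHS]addeAC; congr (_ + _)%E.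
rewrite -[X in _ = (_ + X + _)%E]/((-1)%:E * jordan_neg PN A)%E mulN1e subeK//.
exact: fin_num_measure.
Qed.

Lemma has_integral_cadd n1 n2 f v1 v2 :
  has_integral n1 f v1 -> has_integral n2 f v2 ->
  has_integral (cadd n1 n2) f (v1 + v2).
Proof.
move=> [p1 [q1 [h1 ip1 iq1 ->]]] [p2 [q2 [h2 ip2 iq2 ->]]].
exists (measure_add p1 p2), (measure_add q1 q2); split.
- move=> A mA; rewrite [X in (_ + X)%E]measure_addE [RHS]measure_addE.
  by rewrite -h1// -h2// [RHS]addeACA.
- exact: integrable_measure_add.
- exact: integrable_measure_add.
by rewrite !Rintegral_measure_add// opprD addrACA.
Qed.

Lemma has_integral_copp nu f v :
  has_integral nu f v -> has_integral (copp nu) f (- v).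
Proof.
move=> [p [q [h ip iq ->]]]; exists q, p; split => //; last by rewrite opprB.
move=> A mA; rewrite -h// /copp addeA [X in (X + _)%E]addeC.
by rewrite subee ?add0e// fin_num_measure.
Qed.

(** The splitting comes from the positive and negative parts of [h], each the density of a measure;
    their products with [f] are dominated by [f * h] in absolute value. *)
Lemma has_integral_induced (m : {finite_measure set T -> \bar R}) h
    (ih : m.-integrable setT (EFin \o h)) f :
  measurable_fun setT f ->
  m.-integrable setT (EFin \o (fun x => f x * h x)) ->
  has_integral (induced_charge ih) f (Rintegral m setT (fun x => f x * h x)).
Proof.
move=> mf ifh.
have mT := @measurableT _ T.
have hE x : h x = h^\+%R x - h^\-%R x by rewrite -[in LHS](funrposBneg h).
have ihp := integrable_funrpos mT ih.
have ihn := integrable_funrneg mT ih.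
have mh : measurable_fun setT h.
  by apply/measurable_EFinP; exact: measurable_int ih.
have mfh : measurable_fun setT (fun x => f x * h x) by exact: measurable_funM.
have ifhp : m.-integrable setT (EFin \o (fun x => f x * h^\+%R x)).
  apply: (le_integrable mT _ _ ifh) => [|x _].
    by apply/measurable_EFinP; apply: measurable_funM => //; exact: measurable_funrpos.
  rewrite lee_fin !normrM ler_wpM2l//.
  by rewrite (ger0_norm (funrpos_ge0 _ _)) /funrpos ge_max ler_norm normr_ge0.
have ifhn : m.-integrable setT (EFin \o (fun x => f x * h^\-%R x)).
  apply: (le_integrable mT _ _ ifh) => [|x _].
    by apply/measurable_EFinP; apply: measurable_funM => //; exact: measurable_funrneg.
  rewrite lee_fin !normrM ler_wpM2l//.
  by rewrite (ger0_norm (funrneg_ge0 _ _)) /funrneg ge_max -normrN ler_norm normr_ge0.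
exists (density_measure (@funrpos_ge0 _ _ h) ihp).
exists (density_measure (@funrneg_ge0 _ _ h) ihn); split.
- move=> A mA; rewrite /density_measure /measure_of_charge /induced_charge.
  rewrite -integralD//; [|exact: integrableS ih|exact: integrableS ihn].
  apply: eq_integral => x _; rewrite /= -EFinD; congr EFin.
  by rewrite hE subrK.
- exact: integrable_density_measure.
- exact: integrable_density_measure.
rewrite {2 3}/Rintegral !integral_density_measure// -/(Rintegral _ _ _).
rewrite -[X in _ = _ - X]/(Rintegral _ _ _) -RintegralB//.
apply: eq_Rintegral => x _.
by rewrite hE mulrBr.
Qed.

Lemma has_integral_signed_density nu h (ih : signed_integrable nu h) f :
  measurable_fun setT f -> signed_integrable nu (fun x => f x * h x) ->
  has_integral (signed_density ih) f (signed_integral nu setT (fun x => f x * h x)).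
Proof.
move=> mf [ip iN]; apply: has_integral_cadd; first exact: has_integral_induced.
by apply: has_integral_copp; exact: has_integral_induced.
Qed.

End has_integral.

(** * Linearity of the integrals, and integration against a complex density *)

Section signed_integral_linear.
Context d (T : measurableType d) (R : realType).
Variables (nu : {charge set T -> \bar R}).
Implicit Types (f g : T -> R).

Lemma signed_integrableD f g :
  signed_integrable nu f -> signed_integrable nu g ->
  signed_integrable nu (fun x => f x + g x).
Proof. by case=> fp fn [gp gn]; split; [exact: (integrableD measurableT fp gp)
                                |exact: (integrableD measurableT fn gn)].
Qed.

Lemma signed_integrableZ c f :
  signed_integrable nu f -> signed_integrable nu (fun x => c * f x).
Proof. by case=> fp fn; split; [exact: (integrableZl measurableT c fp)
                        |exact: (integrableZl measurableT c fn)].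
Qed.

Lemma signed_integralD f g :
  signed_integrable nu f -> signed_integrable nu g ->
  signed_integral nu setT (fun x => f x + g x) =
  signed_integral nu setT f + signed_integral nu setT g.
Proof.
by case=> fp fn [gp gn]; rewrite /signed_integral !RintegralD// opprD addrACA.
Qed.

Lemma signed_integralZ c f : signed_integrable nu f ->
  signed_integral nu setT (fun x => c * f x) = c * signed_integral nu setT f.
Proof. by case=> fp fn; rewrite /signed_integral !RintegralZl// mulrBr. Qed.

Lemma signed_integrable_measurable f :
  signed_integrable nu f -> measurable_fun setT f.
Proof. by case=> /integrableP[/measurable_EFinP]. Qed.

End signed_integral_linear.

Section complex_integral_linear.
Context d (T : measurableType d) (R : realType).
Variables (mu : complex_measure T R).
Implicit Types (g w : T -> R[i]).

Lemma complex_integral_linear (c : R[i]) g w :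
  complex_integrable mu g -> complex_integrable mu w ->
  complex_integrable mu (fun x => c * g x + w x) /\
  complex_integral mu setT (fun x => c * g x + w x) =
  c * complex_integral mu setT g + complex_integral mu setT w.
Proof.
case: c => a b [g1 g2 g3 g4] [w1 w2 w3 w4].
have eRe : (fun x => complex.Re ((a +i* b) * g x + w x)) =
    (fun x => a * complex.Re (g x) + - b * complex.Im (g x) + complex.Re (w x)).
  by apply/funext => x; case: (g x) (w x) => [? ?] [? ?] /=; rewrite mulNr.
have eIm : (fun x => complex.Im ((a +i* b) * g x + w x)) =
    (fun x => a * complex.Im (g x) + b * complex.Re (g x) + complex.Im (w x)).
  by apply/funext => x; case: (g x) (w x) => [? ?] [? ?] /=.
split.
  by split; rewrite ?eRe ?eIm; do !apply: signed_integrableD => //;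
    exact: signed_integrableZ.
rewrite /complex_integral eRe eIm !signed_integralD ?signed_integralZ//;
  try (do ?apply: signed_integrableD => //; exact: signed_integrableZ).
by apply/eqP; rewrite eq_complex /=; apply/andP; split; apply/eqP; ring.
Qed.

(** The last two hypotheses supply integrability, against both parts of [mu], of the four products
    of a real or imaginary part of [g] with one of [w]; the real density lemma is applied to each of
    these. *)
Lemma complex_integral_density w (h : complex_integrable mu w) g :
  complex_integrable mu g ->
  complex_integrable mu (fun x => (complex.Re (g x))%:C * w x) ->
  complex_integrable mu (fun x => (complex.Im (g x))%:C * w x) ->
  complex_integral (complex_density h) setT g =
  complex_integral mu setT (fun x => w x * g x).
Proof.
move=> ig igr igi.
have [/signed_integrable_measurable mgr /signed_integrable_measurable mgi _ _] := ig.
have -> : (fun x => w x * g x) = (fun x =>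
    'i * ((complex.Im (g x))%:C * w x) + (complex.Re (g x))%:C * w x).
  apply/funext => x; case: (g x) (w x) => [a b] [e f]; apply/eqP.
  by rewrite eq_complex /=; apply/andP; split; apply/eqP; ring.
rewrite (complex_integral_linear _ igi igr).2.
have eR (a : T -> R) : (fun x => complex.Re ((a x)%:C * w x)) =
    (fun x => a x * complex.Re (w x)).
  by apply/funext => x; case: (w x) => ? ? /=; rewrite mul0r subr0.
have eI (a : T -> R) : (fun x => complex.Im ((a x)%:C * w x)) =
    (fun x => a x * complex.Im (w x)).
  by apply/funext => x; case: (w x) => ? ? /=; rewrite mul0r addr0.
case: igr; rewrite !eR !eI => r1 r2 r3 r4.
case: igi; rewrite !eR !eI => i1 i2 i3 i4.
rewrite /complex_integral !eR !eI.
case: h => hrr hri hir hii /=.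
(* The four rewrites evaluate the integrals of the real and imaginary parts of [g] against the real
   and imaginary parts of the density. *)
have [_ ->] := has_integral_signed (has_integral_cadd
  (has_integral_signed_density hrr mgr r1)
  (has_integral_copp (has_integral_signed_density hii mgr r4))).
have [_ ->] := has_integral_signed (has_integral_cadd
  (has_integral_signed_density hir mgi i3)
  (has_integral_signed_density hri mgi i2)).
have [_ ->] := has_integral_signed (has_integral_cadd
  (has_integral_signed_density hir mgr r3)
  (has_integral_signed_density hri mgr r2)).
have [_ ->] := has_integral_signed (has_integral_cadd
  (has_integral_signed_density hrr mgi i1)
  (has_integral_copp (has_integral_signed_density hii mgi i4))).
apply/eqP; rewrite eq_complex /=.
by apply/andP; split; apply/eqP; ring.
Qed.

End complex_integral_linear.

(** * Polynomial integrands and the moment functionals *)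

Section polynomial_integral.
Context (R : realType).
Implicit Types (mu : complex_measure (measurableTypeR R) R) (Q : {poly R[i]}).

Lemma complex_integrable_poly mu Q : finite_moments mu ->
  complex_integrable mu (fun x : R => Q.[x%:C]).
Proof.
move=> h; rewrite (_ : (fun x => _) =
    fun x : R => \sum_(i < size Q) Q`_i * x%:C ^+ i); last first.
  by apply/funext => x; rewrite horner_coef.
elim: (index_enum _) => [|i s ih].
  (* The empty sum is written as a combination of moments of order 0, so that linearity also covers
     the zero function. *)
  rewrite (_ : (fun x => _) = fun x : R => (-1) * x%:C ^+ 0 + x%:C ^+ 0).
    by apply: (complex_integral_linear _ _ _).1; exact: h.
  by apply/funext => x; rewrite big_nil expr0 mulr1 addNr.
rewrite (_ : (fun x => _) = fun x : R =>
    Q`_i * x%:C ^+ i + \sum_(j <- s) Q`_j * x%:C ^+ j).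
  by apply: (complex_integral_linear _ _ ih).1; exact: h.
by apply/funext => x; rewrite big_cons.
Qed.

(** At real points the real and imaginary parts can be taken coefficientwise. Polynomial
    integrability thereby covers the hypotheses of [complex_integral_density]. *)
Lemma Re_Im_poly Q : exists Q1 Q2 : {poly R[i]}, forall x : R,
  (complex.Re Q.[x%:C])%:C = Q1.[x%:C] /\ (complex.Im Q.[x%:C])%:C = Q2.[x%:C].
Proof.
elim/poly_ind: Q => [|Q c [Q1 [Q2 ih]]].
  by exists 0, 0 => x; rewrite !horner0.
exists (Q1 * 'X + (complex.Re c)%:C%:P), (Q2 * 'X + (complex.Im c)%:C%:P) => x.
rewrite !hornerE; have [<- <-] := ih x.
case: (Q.[_]) => a b; case: c => e f /=.
by split; apply/eqP; rewrite eq_complex /=; apply/andP; split; apply/eqP; ring.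
Qed.

Lemma complex_integral_shifted_poly mu (h : finite_moments mu) z Q :
  complex_integral (shifted_measure h z) setT (fun x : R => Q.[x%:C]) =
  complex_integral mu setT (fun x : R => (('X - z%:P) * Q).[x%:C]).
Proof.
have [Q1 [Q2 Q12]] := Re_Im_poly Q.
have iP P : complex_integrable mu (fun x : R => P.[x%:C] * (x%:C - z)).
  rewrite (_ : (fun x => _) = fun x : R => (P * ('X - z%:P)).[x%:C]).
    exact: complex_integrable_poly.
  by apply/funext => x; rewrite !hornerE.
rewrite complex_integral_density.
- by congr complex_integral; apply/funext => x; rewrite !hornerE.
- exact: complex_integrable_poly.
- rewrite (_ : (fun x => _) = fun x : R => Q1.[x%:C] * (x%:C - z))//.
  by apply/funext => x; rewrite (Q12 x).1.
- rewrite (_ : (fun x => _) = fun x : R => Q2.[x%:C] * (x%:C - z))//.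
  by apply/funext => x; rewrite (Q12 x).2.
Qed.

Context (r : nat) (n : 'I_r -> nat).
Implicit Type nu : 'I_r -> complex_measure (measurableTypeR R) R.

(** The index is a dependent pair of [j] and an exponent below [n j], so the index type has exactly
    |n| elements. *)
Definition moment_functional nu (i : {j : 'I_r & 'I_(n j)}) Q : R[i] :=
  complex_integral (nu (tag i)) setT (fun x : R => (Q * 'X^(tagged i)).[x%:C]).

Lemma moment_functional_scalar nu i : finite_moments (nu (tag i)) ->
  scalar (moment_functional nu i).
Proof.
move=> h a P Q; rewrite /moment_functional.
rewrite -(complex_integral_linear a _ _).2; try exact: complex_integrable_poly.
by congr complex_integral; apply/funext => x; rewrite mulrDl -scalerAl hornerD hornerZ.
Qed.

(** An equality of predicates, not a pointwise equivalence, so that it can be rewritten under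
    [exists!] in [normal_index]. *)
Lemma typeII_MOP_annihilated nu :
  typeII_MOP nu n = monic_annihilated (moment_functional nu).
Proof.
have cardI : #|{: {j : 'I_r & 'I_(n j)}}| = (\sum_(j < r) n j)%N.
  rewrite card_tagged sumnE big_map big_enum.
  by apply: eq_bigr => j _; rewrite card_ord.
apply/funext => P; apply/propext; rewrite /typeII_MOP /monic_annihilated cardI.
split=> -[mP sP oP]; split=> //.
  move=> [j k]; rewrite -[RHS](oP j k)//; congr complex_integral.
  by apply/funext => x; rewrite !hornerE.
move=> j k kn; rewrite -[RHS](oP (Tagged (fun j => 'I_(n j)) (Ordinal kn))).
by congr complex_integral; apply/funext => x; rewrite !hornerE.
Qed.

End polynomial_integral.

Theorem theorem4p1 (R : realType) (r : nat) (hr : (1 <= r)%N)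
    (mu : 'I_r -> complex_measure (measurableTypeR R) R)
    (hmu : forall j : 'I_r, finite_moments (mu j))
    (n : 'I_r -> nat) (hn : normal_index mu n)
    (P : {poly R[i]}) (hP : typeII_MOP mu n P) :
  [set z0 : R[i] | P.[z0] = 0] =
  [set z0 : R[i] |
    ~ normal_index (fun j : 'I_r => shifted_measure (hmu j) z0) n].
Proof.
apply/funext => z; apply/propext => /=.
rewrite /normal_index typeII_MOP_annihilated.
(* The functionals of the shifted system are those of [mu] precomposed with multiplication by
   ['X - z%:P], the form treated by [root_monic_annihilated]. *)
rewrite (_ : moment_functional _ =
    fun i Q => moment_functional mu i (('X - z%:P) * Q)).
  rewrite /normal_index typeII_MOP_annihilated in hn hP.
  have hl (i : {j : 'I_r & 'I_(n j)}) := moment_functional_scalar (i := i) (hmu (tag i)).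
  by rewrite -(root_monic_annihilated hl z hn hP); split=> /rootP.
apply/funext => i; apply/funext => Q.
by rewrite /moment_functional complex_integral_shifted_poly mulrA.
Qed.
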